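(* Let $\mathbf{x}$ be a set of indeterminates and let $\lambda_n(\mathbf{x}),\mu_n(\mathbf{x}),T_n(\mathbf{x})$ ($n\ge0$) be polynomials with nonnegative coefficients such that $$\sum_{n\ge0}T_n(\mathbf{x})z^n=\cfrac{1}{1-\lambda_0z-\cfrac{\mu_1z^2}{1-\lambda_1z-\cfrac{\mu_2z^2}{1-\lambda_2z-\cdots}}}.$$ Suppose there exist polynomials $\alpha_n(\mathbf{x})$ ($n\ge0$) and $\beta_n(\mathbf{x})$ ($n\ge0$) with nonnegative coefficients such that, with the convention $\alpha_{-1}=0$, $\lambda_n=\beta_n+\alpha_{2n}+\alpha_{2n-1}$ and $\mu_{n+1}=\alpha_{2n}\alpha_{2n+1}$ for all $n\ge0$. Then $(T_n(\mathbf{x}))_{n\ge0}$ is an $\mathbf{x}$-Stieltjes moment sequence and is $3$-$\mathbf{x}$-log-convex.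
   Context: A matrix is $\mathbf{x}$-TP if all its minors are polynomials in $\mathbf{x}$ with nonnegative coefficients; a sequence is an $\mathbf{x}$-Stieltjes moment sequence if its Hankel matrix $[\alpha_{i+j}]_{i,j\ge0}$ is $\mathbf{x}$-TP. Define $\mathcal{L}[\alpha_i]=\alpha_{i-1}\alpha_{i+1}-\alpha_i^2$ ($i\ge1$), $\mathcal{L}^m=\mathcal{L}(\mathcal{L}^{m-1})$; the sequence is $3$-$\mathbf{x}$-log-convex if $\mathcal{L}^m[\alpha_i]$ has nonnegative coefficients for $m\le3$ and all $i$ for which it is defined. *)

(* Defs.v *)
From HB Require Import structures.
From mathcomp Require Export all_boot all_order all_algebra.
From mathcomp Require Export finmap.
From mathcomp.multinomials Require Export monalg.

Set Implicit Arguments.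
Unset Strict Implicit.
Unset Printing Implicit Defensive.

Import Order.TTheory GRing.Theory Num.Theory.
Local Open Scope ring_scope.

Section FormalPowerSeries.
Context {A : comNzRingType}.

(* A formal power series in z over A is its coefficient sequence nat -> A. *)
Definition fps_mul (f g : nat -> A) : nat -> A :=
  fun n => \sum_(i < n.+1) f i * g (n - i)%N.

Fixpoint fps_inv_seq (f : nat -> A) (n : nat) : seq A :=
  if n is m.+1 then
    let s := fps_inv_seq f m in
    rcons s (- \sum_(i < m.+1) f i.+1 * s`_(m - i))
  else [:: 1].

(* The multiplicative inverse of f, meaningful only when f 0 = 1
   (see fps_mulV). *)
Definition fps_inv (f : nat -> A) : nat -> A := fun n => (fps_inv_seq f n)`_n.

Lemma size_fps_inv_seq f n : size (fps_inv_seq f n) = n.+1.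
Proof. by elim: n => //= n IHn; rewrite size_rcons IHn. Qed.

Lemma nth_fps_inv_seq f n k : (k <= n)%N -> (fps_inv_seq f n)`_k = fps_inv f k.
Proof.
elim: n => [|n IHn]; first by case: k.
rewrite leq_eqVlt => /orP[/eqP -> // | le_kn].
by rewrite /= nth_rcons size_fps_inv_seq le_kn IHn.
Qed.

Lemma fps_mulV f : f 0%N = 1 ->
  fps_mul f (fps_inv f) =1 (fun n => (n == 0%N)%:R).
Proof.
move=> f0 [|n]; rewrite /fps_mul big_ord_recl f0 mul1r subn0.
  by rewrite big_ord0 addr0.
rewrite {1}/fps_inv /= nth_rcons size_fps_inv_seq ltnn eqxx.
apply/eqP; rewrite addrC subr_eq0; apply/eqP/eq_bigr => i _.
by rewrite nth_fps_inv_seq ?leq_subr // /bump /= add1n subSS.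
Qed.

(* 1 - l z - m z^2 F(z) *)
Definition jfrac_denom (l m : A) (F : nat -> A) : nat -> A :=
  fun n => match n with
           | 0 => 1
           | 1 => - l
           | n'.+2 => - (m * F n')
           end.

(* The fraction
     1 / (1 - la_j z - mu_(j+1) z^2 / (1 - la_(j+1) z - ...))
   cut after k levels; k = 0 gives 0. *)
Fixpoint jfrac_convergent (la mu : nat -> A) (k j : nat) : nat -> A :=
  if k is k'.+1 then
    fps_inv (jfrac_denom (la j) (mu j.+1) (jfrac_convergent la mu k' j.+1))
  else fun=> 0.

(* The value of the infinite fraction is the coefficientwise (z-adic) limit of
   its convergents. *)
Definition is_jfraction (la mu T : nat -> A) : Prop :=
  forall n : nat, exists K : nat, forall k : nat,
    (K <= k)%N -> jfrac_convergent la mu k 0 n = T n.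

(* The sequence a shifted by one, with the convention a_(-1) = 0. *)
Definition prev (a : nat -> A) (n : nat) : A := if n is m.+1 then a m else 0.

Definition hankel (a : nat -> A) : nat -> nat -> A := fun i j => a (i + j)%N.

(* L[a_i] for i >= 1; at i = 0 the value is junk, as is that of iter m logcvx a
   at every i < m. *)
Definition logcvx (a : nat -> A) : nat -> A :=
  fun i => a i.-1 * a i.+1 - a i ^+ 2.

End FormalPowerSeries.

Section Positivity.
(* {malg R[{cmonom I}]} is the ring of polynomials over R in commuting
   indeterminates indexed by I, finite or not. *)
Context {R : realDomainType} {I : choiceType}.
Local Notation poly := {malg R[{cmonom I}]}.

Definition nonneg_coefs (p : poly) : Prop := forall m : {cmonom I}, 0 <= p@_m.

Definition xTP (M : nat -> nat -> poly) : Prop :=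
  forall (k : nat) (r c : 'I_k -> nat),
    {homo r : i j / (i < j)%N} -> {homo c : i j / (i < j)%N} ->
    nonneg_coefs (\det (\matrix_(i < k, j < k) M (r i) (c j))).

Definition xStieltjes (a : nat -> poly) : Prop := xTP (hankel a).

Definition xlogconvex (k : nat) (a : nat -> poly) : Prop :=
  forall m i : nat, (m <= k)%N -> (m <= i)%N ->
    nonneg_coefs (iter m logcvx a i).

End Positivity.

(* Main.v *)
(* The coefficients T_n are the entries P(n, 0) of the Stieltjes tableau P, whose
   entry P(n, k) counts weighted Motzkin paths from height 0 to height k, and
   the Hankel matrix of T is P D P^T with D diagonal, D_k = mu_1 ... mu_k.  The
   tableau is an iterated product of matrices 1 (+) ... (+) 1 (+) K, where K is
   the tridiagonal production matrix topped by the row (1, 0, 0, ...).  The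
   relations between lambda, mu, alpha and beta say that K is a product of two
   staircase-shaped nonnegative matrices, all of whose minors are products of
   entries, so total positivity follows from the Cauchy-Binet formula.
   Finally, by the Desnanot-Jacobi identity, L, L^2 and L^3 of the sequence are
   polynomials with nonnegative coefficients in the T_n and in Hankel minors of
   orders 2, 3 and 4. *)
Require Import Defs.
From mathcomp Require Import all_fingroup ring zify.

Set Implicit Arguments.
Unset Strict Implicit.
Unset Printing Implicit Defensive.

Import Order.TTheory GRing.Theory Num.Theory.
Local Open Scope ring_scope.

(** * Cauchy-Binet and determinants of staircase matrices *)

Section Determinants.
Context {A : comNzRingType}.

Lemma det_mulmx_expand k n (M : 'M[A]_(k, n)) (N : 'M[A]_(n, k)) :
  \det (M *m N) = \sum_(f : {ffun 'I_k -> 'I_n})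
                    (\prod_i M i (f i)) * \det (rowsub f N).
Proof.
transitivity (\sum_(s : 'S_k) \sum_(f : {ffun 'I_k -> 'I_n})
    (-1) ^+ s * ((\prod_i M i (f i)) * \prod_i N (f i) (s i))).
  apply: eq_bigr => s _; rewrite -big_distrr /=; congr (_ * _).
  under eq_bigr do rewrite mxE.
  by rewrite bigA_distr_bigA /=; apply: eq_bigr => f _; rewrite big_split.
rewrite exchange_big; apply: eq_bigr => f _.
rewrite big_distrr; apply: eq_bigr => s _ /=.
by rewrite mulrCA; congr (_ * (_ * _)); apply: eq_bigr => i _; rewrite mxE.
Qed.

(* Summing over all maps instead of increasing ones counts each minor k! times;
   this is harmless for signs and avoids choosing representatives. *)
Lemma Cauchy_Binet_fact k n (M : 'M[A]_(k, n)) (N : 'M[A]_(n, k)) :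
  \det (M *m N) *+ k`! =
  \sum_(f : {ffun 'I_k -> 'I_n}) \det (colsub f M) * \det (rowsub f N).
Proof.
rewrite -card_Sn -sumr_const.
transitivity (\sum_(s : 'S_k) \sum_(f : {ffun 'I_k -> 'I_n})
    ((-1) ^+ s * \prod_i M i (f (s i))) * \det (rowsub f N)).
  apply: eq_bigr => s _; rewrite det_mulmx_expand.
  (* In the copy of the expansion indexed by s, f is replaced by its composite with s. The resulting
     row permutation of N contributes the sign of s, and summing over s then assembles the minor of
     M. *)
  pose h (t : 'S_k) (f : {ffun 'I_k -> 'I_n}) := [ffun i => f (t i)].
  rewrite (reindex (h s)) /=; last first.
    exists (h s^-1%g) => f _; apply/ffunP => i; rewrite !ffunE.
      by rewrite permKV.
    by rewrite permK.
  apply: eq_bigr => f _.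
  have -> : rowsub (h s f) N = row_perm s (rowsub f N).
    by apply/matrixP => i j; rewrite !mxE ffunE.
  rewrite row_permE det_mulmx det_perm mulrCA mulrA.
  by congr (_ * _ * _); apply: eq_bigr => i _; rewrite ffunE.
rewrite exchange_big; apply: eq_bigr => f _; rewrite -big_distrl /=.
congr (_ * _); apply: eq_bigr => s _; congr (_ * _).
by apply: eq_bigr => i _; rewrite mxE.
Qed.

Lemma increasing_perm k (f : 'I_k -> nat) : injective f ->
  exists s : 'S_k, {homo (fun i => f (s i)) : i j / (i < j)%N}.
Proof.
move=> f_inj; pose t := [tuple f i | i < k].
have : perm_eq (sort leq t) t by rewrite perm_sort.
case/tuple_permP => s def_s; exists s => i j ltij.
have lt_sorted : sorted ltn (sort leq t).
  rewrite ltn_sorted_uniq_leq sort_uniq (sort_sorted leq_total) andbT.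
  by rewrite map_inj_uniq ?enum_uniq.
have nth_s (l : 'I_k) : nth 0%N (sort leq t) l = f (s l).
  by rewrite def_s -tnth_nth !tnth_mktuple.
by rewrite -!nth_s (sorted_ltn_nth ltn_trans) // inE size_sort size_tuple.
Qed.

(** Expanding along the first column or the first row, whichever vanishes off the corner, leaves
    only the corner term; the hypothesis passes to its cofactor. *)
Lemma det_staircase n (M : 'M[A]_n) :
    (forall i : 'I_n, (forall i' : 'I_n, (i < i')%N -> M i' i = 0) \/
                      (forall j' : 'I_n, (i < j')%N -> M i j' = 0)) ->
  \det M = \prod_i M i i.
Proof.
elim: n M => [|n IHn] M stM; first by rewrite det_mx00 big_ord0.
have IH : cofactor M ord0 ord0 = \prod_i M (lift ord0 i) (lift ord0 i).
  rewrite /cofactor expr0 mul1r IHn.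
    by apply: eq_bigr => i _; rewrite !mxE.
  move=> i; case: (stM (lift ord0 i)) => st; [left | right] => j ltij;
    by rewrite !mxE st.
rewrite big_ord_recl -IH; case: (stM ord0) => st.
  rewrite (expand_det_col _ ord0) big_ord_recl big1 ?addr0 // => i _.
  by rewrite st ?mul0r.
rewrite (expand_det_row _ ord0) big_ord_recl big1 ?addr0 // => i _.
by rewrite st ?mul0r.
Qed.

End Determinants.

(** * The Stieltjes tableau and its Gram identity *)

Section StieltjesTableau.
Context {A : comNzRingType} (la mu : nat -> A).

Fixpoint tableau (n k : nat) : A :=
  if n is n'.+1 then
    prev (tableau n') k + la k * tableau n' k + mu k.+1 * tableau n' k.+1
  else (k == 0%N)%:R.

Lemma tableau_gt n k : (n < k)%N -> tableau n k = 0.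
Proof.
elim: n k => [|n IHn] [|k] //= lt_nk.
by rewrite !IHn ?(ltnW lt_nk) // ?mulr0 ?addr0 // ltnW // ltnW.
Qed.

Definition mu_prod (k : nat) : A := \prod_(i < k) mu i.+1.

Lemma sum_prevl w (f g : nat -> A) : f w = 0 ->
  \sum_(k < w.+1) prev f k * g k = \sum_(k < w.+1) f k * g k.+1.
Proof.
by move=> fw; rewrite big_ord_recl mul0r add0r big_ord_recr /= fw mul0r addr0.
Qed.

Lemma sum_delta w (f : nat -> A) k : ((w <= k)%N -> f k = 0) ->
  \sum_(m < w) f m * (m == k :> nat)%:R = f k.
Proof.
move=> fk; have [le_wk|lt_kw] := leqP w k.
  rewrite fk // big1 // => m _; rewrite (_ : (m == k :> nat) = false) ?mulr0 //.
  by have := ltn_ord m; lia.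
rewrite (bigD1 (Ordinal lt_kw)) //= eqxx mulr1 big1 ?addr0 // => m.
by rewrite -val_eqE /= => /negbTE ->; rewrite mulr0.
Qed.

(** One step of the tableau recurrence is self-adjoint for the bilinear form with weights [mu_prod],
    so steps can be moved from row i to row j until row 0 remains. The bound makes the rows involved
    vanish at the cut w, so truncation loses no boundary term. *)
Lemma tableau_gram w i j : (i + j < w.+1)%N ->
  \sum_(k < w.+1) tableau i k * mu_prod k * tableau j k = tableau (i + j) 0.
Proof.
elim: i j => [|i IHi] j lt_ij_w.
  rewrite big_ord_recl big1 ?addr0 => [|k _]; last by rewrite /= !mul0r.
  by rewrite /= /mu_prod big_ord0 !mul1r.
have lt_i : (i < w)%N by lia.
have lt_j : (j < w)%N by lia.
rewrite addSnnS -IHi; last by rewrite addnS -addSn.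
pose S (f g : nat -> A) : A := \sum_(k < w.+1) f k * (mu_prod k * g k).
have shift f g : f w = 0 -> S (prev f) g =
    \sum_(k < w.+1) mu k.+1 * (mu_prod k * (f k * g k.+1)).
  move=> fw; rewrite /S (sum_prevl (fun k => mu_prod k * g k)) //.
  by apply: eq_bigr => k _; rewrite /mu_prod big_ord_recr /=; ring.
transitivity (S (prev (tableau i)) (tableau j)
   + S (prev (tableau j)) (tableau i)
   + \sum_(k < w.+1) la k * (mu_prod k * (tableau i k * tableau j k))).
  rewrite (shift (tableau j)) ?tableau_gt // /S -!big_split /=.
  by apply: eq_bigr => k _; ring.
rewrite (shift (tableau i)) ?tableau_gt // /S -!big_split /=.
by apply: eq_bigr => k _; ring.
Qed.

End StieltjesTableau.

(** * Power series and the continued fraction *)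

Section JFraction.
Context {A : comNzRingType}.
Implicit Types (f g h la mu : nat -> A).

(** Truncation to polynomials lets commutativity and associativity be inherited from the polynomial
    ring. *)
Lemma fps_mulE w f g n : (n < w)%N ->
  fps_mul f g n = ((\poly_(i < w) f i) * (\poly_(i < w) g i))`_n.
Proof.
move=> lt_nw; rewrite coefM; apply: eq_bigr => i _; rewrite !coef_poly.
by rewrite !ifT //; have := ltn_ord i; lia.
Qed.

Lemma fps_mulC f g n : fps_mul f g n = fps_mul g f n.
Proof. by rewrite !(@fps_mulE n.+1) // mulrC. Qed.

Lemma fps_mulA f g h n :
  fps_mul f (fps_mul g h) n = fps_mul (fps_mul f g) h n.
Proof.
have mulE f1 f2 f3 : fps_mul f1 (fps_mul f2 f3) n =
    (\poly_(i < n.+1) f1 i *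
      (\poly_(i < n.+1) f2 i * \poly_(i < n.+1) f3 i))`_n.
  rewrite coefM; apply: eq_bigr => i _.
  by rewrite coef_poly ltn_ord (@fps_mulE n.+1) // ltnS leq_subr.
by rewrite [RHS]fps_mulC !mulE mulrA (mulrC (\poly_(i < n.+1) h i)).
Qed.

Lemma fps_mul1 g n : fps_mul g (fun i => (i == 0%N)%:R) n = g n.
Proof.
rewrite fps_mulC /fps_mul big_ord_recl mul1r subn0 big1 ?addr0 // => i _.
by rewrite mul0r.
Qed.

Lemma fps_mul_prevl f g n : fps_mul (prev f) g n = prev (fps_mul f g) n.
Proof.
by case: n => [|n]; rewrite /fps_mul big_ord_recl mul0r add0r ?big_ord0.
Qed.

Lemma fps_mul_prevr f g n : fps_mul f (prev g) n = prev (fps_mul f g) n.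
Proof.
rewrite fps_mulC fps_mul_prevl; case: n => //= n; exact: fps_mulC.
Qed.

Lemma eq_fps_mul f1 f2 g1 g2 n : f1 =1 f2 -> g1 =1 g2 ->
  fps_mul f1 g1 n = fps_mul f2 g2 n.
Proof. by move=> eq_f eq_g; apply: eq_bigr => i _; rewrite eq_f eq_g. Qed.

Lemma eq_prev f g : f =1 g -> prev f =1 prev g.
Proof. by move=> eq_fg [|n] /=. Qed.

(** This is F = 1 + la_j z F + mu_(j+1) z^2 F' F, read off from denominator times F equal to 1;
    [prev] is multiplication by z. *)
Lemma jfrac_convergentS la mu k j n :
  jfrac_convergent la mu k.+1 j n = (n == 0%N)%:R
    + la j * prev (jfrac_convergent la mu k.+1 j) n
    + mu j.+1 * prev (prev (fps_mul (jfrac_convergent la mu k j.+1)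
                                    (jfrac_convergent la mu k.+1 j))) n.
Proof.
set F := jfrac_convergent la mu k.+1 j; set F' := jfrac_convergent la mu k j.+1.
have := @fps_mulV A (jfrac_denom (la j) (mu j.+1) F') erefl n.
rewrite -[fps_inv _]/F => <-.
case: n => [|n]; rewrite /fps_mul big_ord_recl mul1r.
  by rewrite big_ord0 /= !mulr0 !addr0.
rewrite big_ord_recl /= subSS !subn0.
case: n => [|n]; first by rewrite big_ord0 /= mulr0; ring.
have -> : \sum_(i < n.+1) jfrac_denom (la j) (mu j.+1) F' (bump 0 (bump 0 i)) *
    F (n.+2 - bump 0 (bump 0 i))%N = - (mu j.+1 * fps_mul F' F n).
  rewrite /fps_mul big_distrr -sumrN; apply: eq_bigr => i _ /=.
  by rewrite mulNr mulrA.
by rewrite /= /fps_mul; ring.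
Qed.

Arguments jfrac_convergent : simpl never.

(* The generating function of column k of the tableau is
   z^k F_0 F_1 ... F_k, where F_j is the tail of the fraction at level j. *)
Fixpoint tail_prod la mu K k : nat -> A :=
  if k is k'.+1 then
    prev (fps_mul (tail_prod la mu K k') (jfrac_convergent la mu (K - k) k))
  else jfrac_convergent la mu K 0.

Lemma tail_prod0 la mu K k : (k < K)%N -> tail_prod la mu K k 0 = (k == 0%N)%:R.
Proof.
by case: K k => // K [|k] //= _; rewrite jfrac_convergentS /= !mulr0 !addr0.
Qed.

(** The functional equation of F_k, multiplied by z^k F_0 ... F_(k-1), becomes the tableau
    recurrence. The bound ensures that level k is not yet cut off. *)
Lemma tail_prodS la mu K k n : (k < K)%N ->
  tail_prod la mu K k n.+1 =
    prev (fun l => tail_prod la mu K l n) k + la k * tail_prod la mu K k n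
    + mu k.+1 * tail_prod la mu K k.+1 n.
Proof.
case: k => [|k] lt_kK.
  case: K lt_kK => // K _; rewrite /= jfrac_convergentS /= subSS subn0 add0r.
  by congr (_ + _ * _); apply: eq_prev => i; rewrite fps_mulC.
rewrite [tail_prod _ _ _ k.+2]/= -/(tail_prod la mu K k.+1).
have def_K : (K - k.+1)%N = (K - k.+2).+1 by lia.
rewrite /= def_K.
set G := tail_prod la mu K k; set F := jfrac_convergent la mu _.+1 _.
set F' := jfrac_convergent la mu _ k.+2.
have F_eq i : F i = (i == 0%N)%:R + la k.+1 * prev F i
    + mu k.+2 * prev (prev (fps_mul F' F)) i by exact: jfrac_convergentS.
transitivity (fps_mul G (fun i => (i == 0%N)%:R) n
    + la k.+1 * fps_mul G (prev F) n
    + mu k.+2 * fps_mul G (prev (prev (fps_mul F' F))) n).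
  rewrite /fps_mul !big_distrr -!big_split; apply: eq_bigr => i _ /=.
  by rewrite F_eq; ring.
rewrite fps_mul1 !fps_mul_prevr; congr (_ + _ * _).
apply: eq_prev => i; rewrite fps_mul_prevl.
rewrite fps_mul_prevr; apply: eq_prev => l; rewrite -fps_mulA.
by apply: eq_fps_mul => // m; rewrite fps_mulC.
Qed.

(** Each use of the recurrence lowers n by one and raises k by at most one, so the bound
    persists. *)
Lemma tail_prod_tableau la mu K k n : (n + k < K)%N ->
  tail_prod la mu K k n = tableau la mu n k.
Proof.
elim: n k => [|n IHn] k lt_K; first by rewrite tail_prod0.
rewrite tail_prodS; last by lia.
rewrite [tail_prod _ _ _ k n]IHn 1?[tail_prod _ _ _ k.+1 n]IHn; try lia.
by case: k lt_K => [|k] lt_K //=; rewrite IHn //; lia.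
Qed.

Lemma jfraction_tableau la mu (T : nat -> A) n :
  is_jfraction la mu T -> T n = tableau la mu n 0.
Proof.
(* The depth must be past stabilisation of coefficient n and also exceed n, as the comparison with
   the tableau requires. *)
move=> /(_ n)[K convT]; rewrite -(convT (maxn K n.+1) (leq_maxl _ _)).
by rewrite -(@tail_prod_tableau _ _ (maxn K n.+1)) // addn0 leq_maxr.
Qed.

End JFraction.

(** * Iterated log-convexity in terms of Hankel minors *)

Section HankelIdentities.
Context {A : comNzRingType}.
Implicit Types a : nat -> A.

Definition hankel_det a (k s : nat) : A :=
  \det (\matrix_(i < k, j < k) a (s + i + j)%N).

Lemma hankel_det2 a s : hankel_det a 2 s = a s * a s.+2 - a s.+1 ^+ 2.
Proof.
rewrite /hankel_det (expand_det_row _ ord0) !big_ord_recl big_ord0 /cofactor.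
rewrite !det_mx11 !mxE /= /bump /= !addn0 !addnS !addn0.
by ring.
Qed.

Lemma hankel_det3 a s : hankel_det a 3 s =
  a s * a s.+2 * a s.+4 + (a s.+1 * a s.+2 * a s.+3) *+ 2
  - a s.+2 ^+ 3 - a s * a s.+3 ^+ 2 - a s.+1 ^+ 2 * a s.+4.
Proof.
rewrite /hankel_det (expand_det_row _ ord0) !big_ord_recl big_ord0 /cofactor.
rewrite !(expand_det_row _ ord0) !big_ord_recl !big_ord0 /cofactor.
rewrite !det_mx11 !mxE /= /bump /= !addn0 !addnS !addn0.
by ring.
Qed.

(* The Desnanot-Jacobi identity for a 4 x 4 Hankel matrix. *)
Lemma hankel_det4 a s :
  hankel_det a 3 s * hankel_det a 3 s.+2 - hankel_det a 3 s.+1 ^+ 2 =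
  hankel_det a 4 s * hankel_det a 2 s.+2.
Proof.
rewrite !hankel_det3 hankel_det2.
rewrite /hankel_det (expand_det_row _ ord0) !big_ord_recl big_ord0 /cofactor.
rewrite !(expand_det_row _ ord0) !big_ord_recl !big_ord0 /cofactor.
rewrite !(expand_det_row _ ord0) !big_ord_recl !big_ord0 /cofactor.
rewrite !det_mx11 !mxE /= /bump /= !addn0 !addnS !addn0.
by ring.
Qed.

Lemma logcvx_hankel a s : logcvx a s.+1 = hankel_det a 2 s.
Proof. by rewrite hankel_det2. Qed.

(** This is the Desnanot-Jacobi identity for a 3 x 3 Hankel matrix, whose central entry is the
    factor a_(s+2). *)
Lemma logcvx2_hankel a s :
  iter 2 logcvx a s.+2 = a s.+2 * hankel_det a 3 s.
Proof. by rewrite hankel_det3 /= /logcvx /=; ring. Qed.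

(** In the expansion of L applied to L^2, write a_(s+2) a_(s+4) as the order-2 minor plus a_(s+3)^2;
    Desnanot-Jacobi then absorbs the negative term. *)
Lemma logcvx3_hankel a s : iter 3 logcvx a s.+3 =
  hankel_det a 2 s.+2 * (hankel_det a 3 s * hankel_det a 3 s.+2)
  + a s.+3 ^+ 2 * (hankel_det a 4 s * hankel_det a 2 s.+2).
Proof.
rewrite iterS {1}/logcvx !logcvx2_hankel -hankel_det4 hankel_det2.
by ring.
Qed.

End HankelIdentities.

(** * Total positivity over an abstract cone of nonnegative elements *)

Section TotalPositivity.
Context {A : comNzRingType} {nonneg : A -> Prop}.
Context (nonneg0 : nonneg 0) (nonneg1 : nonneg 1).
Context (nonnegD : forall p q, nonneg p -> nonneg q -> nonneg (p + q)).
Context (nonnegM : forall p q, nonneg p -> nonneg q -> nonneg (p * q)).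
Context (nonnegMn_inv : forall p n, nonneg (p *+ n.+1) -> nonneg p).
Implicit Types M N : nat -> nat -> A.

Definition TP M : Prop :=
  forall (k : nat) (r c : 'I_k -> nat),
    {homo r : i j / (i < j)%N} -> {homo c : i j / (i < j)%N} ->
    nonneg (\det (\matrix_(i < k, j < k) M (r i) (c j))).

Lemma nonneg_sum (J : Type) (r : seq J) (P : pred J) (F : J -> A) :
  (forall j, P j -> nonneg (F j)) ->
  nonneg (\sum_(j <- r | P j) F j).
Proof.
by move=> F0; elim/big_rec: _ => [|j p /F0]; [exact: nonneg0|exact: nonnegD].
Qed.

Lemma nonneg_prod (J : Type) (r : seq J) (P : pred J) (F : J -> A) :
  (forall j, P j -> nonneg (F j)) ->
  nonneg (\prod_(j <- r | P j) F j).
Proof.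
by move=> F0; elim/big_rec: _ => [|j p /F0]; [exact: nonneg1|exact: nonnegM].
Qed.

(** By Cauchy-Binet, k! times a minor is a sum over maps f. Non-injective maps contribute 0, since
    rows of the second factor repeat; injective ones give products of genuine minors after sorting.
    Finally [nonnegMn_inv] cancels k!. *)
Lemma TP_mul w M N : TP M -> TP N ->
  TP (fun i j => \sum_(m < w) M i m * N m j).
Proof.
move=> tpM tpN k r c homo_r homo_c.
pose M' := \matrix_(i < k, m < w) M (r i) m.
pose N' := \matrix_(m < w, j < k) N m (c j).
have -> : \matrix_(i < k, j < k) (\sum_(m < w) M (r i) m * N m (c j)) =
    M' *m N'.
  by apply/matrixP => i j; rewrite !mxE; apply: eq_bigr => m _; rewrite !mxE.
apply: (@nonnegMn_inv _ (k`!).-1); rewrite prednK ?fact_gt0 //.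
rewrite Cauchy_Binet_fact; apply: nonneg_sum => f _.
have [/injectiveP f_inj | /injectivePn[i [j neq_ij eq_f]]] :=
  boolP (injectiveb f); last first.
  rewrite (determinant_alternate (A := rowsub f N') neq_ij); last first.
    by move=> l; rewrite !mxE eq_f.
  by rewrite mulr0; exact: nonneg0.
have [|s homo_s] := @increasing_perm k (fun i => f i).
  by move=> i j /val_inj /f_inj.
(* Sorting the inner indices multiplies both determinants by the same sign, which therefore
   cancels. *)
suff -> : \det (colsub f M') * \det (rowsub f N') =
    \det (\matrix_(i, j) M (r i) (f (s j))) *
    \det (\matrix_(i, j) N (f (s i)) (c j)).
  by apply: nonnegM; [exact: tpM | exact: tpN].
have -> : \matrix_(i, j) M (r i) (f (s j)) = col_perm s (colsub f M').
  by apply/matrixP => i j; rewrite !mxE.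
have -> : \matrix_(i, j) N (f (s i)) (c j) = row_perm s (rowsub f N').
  by apply/matrixP => i j; rewrite !mxE.
rewrite row_permE col_permE !det_mulmx !det_perm odd_permV.
by rewrite -mulrA (mulrA ((-1) ^+ s)) -expr2 sqrr_sign mul1r.
Qed.

(* The minors of such a matrix are products of entries. *)
Lemma TP_staircase M :
    (forall i j, nonneg (M i j)) ->
    (forall i j, (forall i', (i < i')%N -> M i' j = 0) \/
                 (forall j', (j < j')%N -> M i j' = 0)) ->
  TP M.
Proof.
move=> M0 stM k r c homo_r homo_c; rewrite det_staircase => [|i].
  by apply: nonneg_prod => i _; rewrite mxE.
by case: (stM (r i) (c i)) => st; [left|right] => j lt_ij;
  rewrite mxE st ?homo_r ?homo_c.
Qed.

Lemma eq_TP M N : (forall i j, M i j = N i j) -> TP M -> TP N.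
Proof.
move=> eqMN tpM k r c homo_r homo_c.
suff <- : \matrix_(i < k, j < k) M (r i) (c j) =
    \matrix_(i, j) N (r i) (c j) by exact: tpM.
by apply/matrixP => i j; rewrite !mxE.
Qed.

Definition block1 M : nat -> nat -> A := fun i j =>
  match i, j with
  | 0, 0 => 1
  | i'.+1, j'.+1 => M i' j'
  | _, _ => 0
  end.

(** If index 0 occurs among both rows and columns, expansion at the corner leaves a minor of M; if
    it occurs on one side only, a row or column is zero; otherwise the minor is one of M with all
    indices lowered by one. *)
Lemma TP_block1 M : TP M -> TP (block1 M).
Proof.
move=> tpM k r c homo_r homo_c.
case: k => [|k] in r c homo_r homo_c *.
  by rewrite det_mx00; exact: nonneg1.
have pos (h : 'I_k.+1 -> nat) : {homo h : i j / (i < j)%N} ->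
    forall i, (0 < h (lift ord0 i))%N.
  by move=> homo_h i; rewrite (leq_ltn_trans _ (homo_h ord0 _ _)).
have homo_pred n (h : 'I_n -> nat) : (forall i, 0 < h i)%N ->
    {homo h : i j / (i < j)%N} -> {homo (fun i => (h i).-1) : i j / (i < j)%N}.
  by move=> h0 homo_h i j /homo_h; have := h0 i; lia.
have block1S i j : (0 < i)%N -> (0 < j)%N -> block1 M i j = M i.-1 j.-1.
  by case: i j => [|i] [|j].
case: (posnP (r ord0)) => r0.
  rewrite (expand_det_row _ ord0) big_ord_recl big1 ?addr0; last first.
    move=> i _; rewrite mxE r0 /=.
    by case: (c _) (pos c homo_c i) => //= j _; rewrite mul0r.
  rewrite mxE r0 /=; case: (c ord0) => [|j] /=; last first.
    by rewrite mul0r; exact: nonneg0.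
  rewrite mul1r /cofactor expr0 mul1r.
  pose r' i := (r (lift ord0 i)).-1; pose c' i := (c (lift ord0 i)).-1.
  suff -> : row' ord0 (col' ord0
        (\matrix_(i < k.+1, j < k.+1) block1 M (r i) (c j))) =
      \matrix_(i, j) M (r' i) (c' j).
    by apply: tpM; apply: homo_pred; try exact: pos;
      move=> i j ltij; [apply: homo_r | apply: homo_c].
  by apply/matrixP => i j; rewrite !mxE block1S ?pos.
case: (posnP (c ord0)) => c0.
  rewrite (expand_det_col _ ord0) big1; first exact: nonneg0.
  move=> i _; rewrite mxE c0.
  have: (0 < r i)%N.
    by case: (unliftP ord0 i) => [j ->|-> //]; exact: pos.
  by case: (r i) => //= j _; rewrite mul0r.
have pos' (h : 'I_k.+1 -> nat) : {homo h : i j / (i < j)%N} ->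
    (0 < h ord0)%N -> forall i, (0 < h i)%N.
  by move=> homo_h h0 i; case: (unliftP ord0 i) => [j ->|-> //]; exact: pos.
suff -> : \matrix_(i < k.+1, j < k.+1) block1 M (r i) (c j) =
    \matrix_(i, j) M (r i).-1 (c j).-1.
  by apply: (tpM k.+1 (fun i => (r i).-1) (fun i => (c i).-1));
    apply: homo_pred => //; exact: pos'.
by apply/matrixP => i j; rewrite !mxE; apply: block1S; exact: pos'.
Qed.

Lemma TP_tr M : TP M -> TP (fun i j => M j i).
Proof.
move=> tpM k r c homo_r homo_c; rewrite -det_tr.
suff -> : (\matrix_(i < k, j < k) M (c j) (r i))^T =
    \matrix_(i, j) M (c i) (r j) by exact: tpM.
by apply/matrixP => i j; rewrite !mxE.
Qed.

(** A minor sees only finitely many entries. This allows infinite matrix products to be replaced by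
    truncated sums that are correct on a finite corner. *)
Lemma TP_local M :
    (forall n, exists2 N, TP N &
       forall i j, (i <= n)%N -> (j <= n)%N -> N i j = M i j) ->
  TP M.
Proof.
move=> locM k r c homo_r homo_c.
have [N tpN eqMN] := locM (maxn (\max_i r i) (\max_i c i)).
suff <- : \matrix_(i < k, j < k) N (r i) (c j) =
    \matrix_(i, j) M (r i) (c j) by exact: tpN.
apply/matrixP => i j; rewrite !mxE eqMN // leq_max; first by rewrite leq_bigmax.
by rewrite (leq_bigmax (F := c)) orbT.
Qed.

(** * Factorization of the production matrix; positivity of the tableau and its Hankel matrix *)

Section Tableau.
Context {la mu al be : nat -> A}.
Context (al0 : forall n, nonneg (al n)) (be0 : forall n, nonneg (be n)).
Context (laE : forall n, la n = be n + al (2 * n)%N + prev al (2 * n)%N).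
Context (muE : forall n, mu n.+1 = al (2 * n)%N * al (2 * n + 1)%N).

(* The tridiagonal production matrix of the tableau, preceded by the row
   (1, 0, 0, ...), factors as left_factor * right_factor: the inner index 2k+1
   carries the weight be k, the inner index 2k+2 lies between heights k and
   k+1. *)
Definition left_factor (i m : nat) : A :=
  if i is k.+1 then
    if m == (2 * k)%N then prev al (2 * k)%N else
    if m == (2 * k).+1 then be k else (m == (2 * k).+2)%:R
  else (m == 0%N)%:R.

Definition right_factor (m k : nat) : A :=
  if (m == 2 * k)%N || (m == (2 * k).+1) then 1 else
  if m == (2 * k).+2 then al (2 * k)%N else 0.

Definition production (k j : nat) : A :=
  (k.+1 == j)%:R + la k * (k == j)%:R + mu j.+1 * (k == j.+1)%:R.

Lemma nonneg_nat (b : bool) : nonneg b%:R.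
Proof. by case: b. Qed.

Lemma TP_left_factor : TP left_factor.
Proof.
apply: TP_staircase => [[|k] m | [|k] m] /=.
- exact: nonneg_nat.
- case: ifP => _; first by case: (2 * k)%N => [|l] /=.
  by case: ifP => _; [exact: be0 | exact: nonneg_nat].
- by right => -[].
(* Row [k.+1] is supported on 2k, 2k+1, 2k+2, and every lower row starts at 2k+2 or later. *)
have [le_m|lt_m] := leqP m (2 * k).+1.
  left => -[//|k'] lt_k; rewrite /left_factor.
  rewrite (_ : (m == (2 * k').+1) = false); last by lia.
  rewrite (_ : (m == (2 * k').+2) = false); last by lia.
  by case: ifP => // /eqP; lia.
right => m' lt_m'; rewrite !ifF; try lia.
by rewrite (_ : (m' == (2 * k).+2) = false) //; lia.
Qed.

Lemma TP_right_factor : TP right_factor.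
Proof.
apply: TP_staircase => m k; rewrite /right_factor.
  by case: ifP => _ //; case: ifP.
have [le_m|lt_m] := leqP m (2 * k).+1.
  by right => k' lt_k; rewrite !ifF //; lia.
by left => m' lt_m'; rewrite !ifF //; lia.
Qed.

Lemma right_factorE k j :
  [/\ right_factor (2 * k) j = (k == j)%:R + al (2 * j)%N * (k == j.+1)%:R,
      right_factor (2 * k).+1 j = (k == j)%:R
    & right_factor (2 * k).+2 j = (k.+1 == j)%:R + al (2 * j)%N * (k == j)%:R].
Proof.
have E1 : ((2 * k == 2 * j) || (2 * k == (2 * j).+1))%N = (k == j) by lia.
have E2 : ((2 * k).+1 == 2 * j)%N || ((2 * k).+1 == (2 * j).+1) = (k == j).
  by lia.
have E3 : ((2 * k).+2 == 2 * j)%N || ((2 * k).+2 == (2 * j).+1) = (k.+1 == j).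
  by lia.
have E4 : (2 * k == (2 * j).+2)%N = (k == j.+1) by lia.
have E5 : ((2 * k).+1 == (2 * j).+2)%N = false by lia.
have E6 : ((2 * k).+2 == (2 * j).+2)%N = (k == j) by lia.
rewrite /right_factor E1 E2 E3 E4 E5 E6.
split.
- case: (eqVneq k j) => [->|_]; last by case: (k == j.+1) => /=; ring.
  by rewrite (ltn_eqF (ltnSn j)) /=; ring.
- by case: (k == j).
case: (eqVneq k j) => [->|_]; last by case: (k.+1 == j) => /=; ring.
by rewrite (gtn_eqF (ltnSn j)) /=; ring.
Qed.

Lemma left_factorS k m :
  left_factor k.+1 m = prev al (2 * k)%N * (m == 2 * k)%N%:R
    + be k * (m == (2 * k).+1)%:R + (m == (2 * k).+2)%:R.
Proof.
rewrite /left_factor; case: eqVneq => [->|_].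
  by rewrite (ltn_eqF (ltnSn _)) (ltn_eqF (ltnW (ltnSn _))) /=; ring.
case: eqVneq => [->|_]; first by rewrite (ltn_eqF (ltnSn _)) /=; ring.
by rewrite /=; ring.
Qed.

(** For row k+1, the diagonal entry is al_(2k-1) + be_k + al_(2k) = la_k, the entry above it is 1,
    and the one in column k-1 is al_(2k-1) al_(2k-2) = mu_k. The bound keeps all inner indices in
    the support of row i. *)
Lemma production_factor w i j : ((2 * i).+1 < w)%N ->
  \sum_(m < w) left_factor i m * right_factor m j =
  if i is k.+1 then production k j else (j == 0%N)%:R.
Proof.
case: i => [|k] lt_kw.
  under eq_bigr do rewrite mulrC.
  rewrite (@sum_delta _ _ (right_factor^~ j)); last by lia.
  by have [-> _ _] := right_factorE 0 j; rewrite eq_sym mulr0 addr0.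
transitivity (
    \sum_(m < w) prev al (2 * k)%N * right_factor m j
      * (m == (2 * k)%N :> nat)%:R
  + \sum_(m < w) be k * right_factor m j * (m == (2 * k).+1 :> nat)%:R
  + \sum_(m < w) right_factor m j * (m == (2 * k).+2 :> nat)%:R).
  rewrite -!big_split; apply: eq_bigr => m _.
  by rewrite left_factorS /=; ring.
rewrite (@sum_delta _ _ (fun m => prev al (2 * k)%N * right_factor m j));
  last by lia.
rewrite (@sum_delta _ _ (fun m => be k * right_factor m j)); last by lia.
rewrite (@sum_delta _ _ (right_factor^~ j)); last by lia.
have [-> -> ->] := right_factorE k j.
rewrite /production laE muE; case: (eqVneq k j) => [->|_].
  by rewrite [j == j.+1]ltn_eqF //=; ring.
case: eqVneq => [->|_]; last by rewrite /=; ring.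
rewrite (_ : prev al (2 * j.+1) = al (2 * j + 1)%N); first by rewrite /=; ring.
by rewrite mulnS addn1.
Qed.

Lemma tableau_production w n k : (n < w)%N ->
  tableau la mu n.+1 k = \sum_(m < w) tableau la mu n m * production m k.
Proof.
move=> lt_nw; pose P := tableau la mu n.
have P0 m : (w <= m)%N -> P m = 0 by move=> le_wm; apply: tableau_gt; lia.
transitivity (\sum_(m < w) P m * (m.+1 == k :> nat)%:R
  + \sum_(m < w) la m * P m * (m == k :> nat)%:R
  + \sum_(m < w) mu k.+1 * P m * (m == k.+1 :> nat)%:R).
  rewrite (@sum_delta _ _ (fun m => la m * P m)); last first.
    by move=> /P0 ->; rewrite mulr0.
  rewrite (@sum_delta _ _ (fun m => mu k.+1 * P m)); last first.
    by move=> /P0 ->; rewrite mulr0.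
  congr (_ + _ + _); case: k => [|k].
    by rewrite big1 // => m _; rewrite mulr0.
  under eq_bigr do rewrite eqSS.
  by rewrite sum_delta //; exact: P0.
by rewrite -!big_split; apply: eq_bigr => m _; rewrite /production /P /=; ring.
Qed.

(** If Q matches rows 0 to n, then [block1 Q] times the production matrix topped by (1, 0, 0, ...)
    matches rows 0 to n+1: row 0 is reproduced and every other row advances by one step. *)
Lemma TP_tableau : TP (tableau la mu).
Proof.
apply: TP_local => n.
suff [Q tpQ eqQ] : exists2 Q, TP Q &
    forall i k, (i <= n)%N -> Q i k = tableau la mu i k.
  by exists Q => // i j le_in _; exact: eqQ.
elim: n => [|n [Q tpQ eqQ]].
  (* Only row 0 has to agree here, so the identity matrix serves. *)
  exists (fun i j => (i == j)%:R) => [|[|//] j _]; last by rewrite eq_sym.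
  apply: TP_staircase => i j; first exact: nonneg_nat.
  have [le_ij|lt_ji] := leqP i j; [right=> j' lt_j'|left=> i' lt_i'];
    rewrite (_ : (_ == _) = false) //; lia.
(* This is the least width that [production_factor] accepts for every row up to n+1. *)
pose K i j := \sum_(m < (2 * n.+1).+2) left_factor i m * right_factor m j.
exists (fun i k => \sum_(m < n.+2) block1 Q i m * K m k).
  apply: TP_mul; first exact: TP_block1.
  by apply: TP_mul; [exact: TP_left_factor | exact: TP_right_factor].
move=> [|i] k le_in; rewrite big_ord_recl /=.
  rewrite /K production_factor // mul1r big1 ?addr0 // => m _.
  by rewrite mul0r.
rewrite mul0r add0r -/(tableau la mu i.+1 k) (@tableau_production n.+1) //.
apply: eq_bigr => m _; rewrite eqQ // /K production_factor //=.
by have := ltn_ord m; rewrite /bump; lia.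
Qed.

Lemma TP_hankel_tableau : TP (hankel (fun n => tableau la mu n 0)).
Proof.
pose D i j := if i == j then mu_prod mu i else 0.
have tpD : TP D.
  apply: TP_staircase => i j; rewrite /D.
    case: ifP => // _; apply: nonneg_prod => l _; rewrite muE.
    by apply: nonnegM; exact: al0.
  have [le_ij|lt_ji] := leqP i j; [right=> j' lt_j'|left=> i' lt_i'];
    rewrite ifF //; lia.
(* For i and j at most n, the cut at n + n meets the bound of [tableau_gram]. *)
apply: TP_local => n; pose w := (n + n)%N.
pose DP i j := \sum_(m < w.+1) D i m * tableau la mu j m.
exists (fun i j => \sum_(m < w.+1) tableau la mu i m * DP m j).
  apply: TP_mul; first exact: TP_tableau.
  exact: (TP_mul w.+1 tpD (TP_tr TP_tableau)).
move=> i j le_in le_jn; rewrite /hankel -(@tableau_gram _ _ _ w); last by lia.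
apply: eq_bigr => m _; rewrite -mulrA; congr (_ * _).
rewrite /DP (bigD1 m) //= /D eqxx big1 ?addr0 // => l.
by rewrite eq_sym -val_eqE /= => /negbTE ->; rewrite mul0r.
Qed.

End Tableau.

Lemma nonneg_hankel_det a k s : TP (hankel a) -> nonneg (hankel_det a k s).
Proof.
move=> tpH; rewrite /hankel_det.
suff <- : \matrix_(i < k, j < k) hankel a (s + i)%N j =
    \matrix_(i, j) a (s + i + j)%N.
  apply: (tpH k (fun i => s + i)%N (fun j => j)) => // i j.
  by rewrite ltn_add2l.
by apply/matrixP => i j; rewrite !mxE.
Qed.

Lemma TP_hankel_logcvx a m i : TP (hankel a) -> (m <= 3)%N -> (m <= i)%N ->
  nonneg (iter m logcvx a i).
Proof.
move=> tpH; have nn k s := @nonneg_hankel_det a k s tpH.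
have a0 n : nonneg (a n).
  by have := nn 1%N n; rewrite /hankel_det det_mx11 !mxE /= !addn0.
case: m => [|[|[|[|//]]]] _; first by rewrite /= => _; exact: a0.
- by case: i => // i _; rewrite iterS logcvx_hankel.
- by case: i => [|[|i]] // _; rewrite logcvx2_hankel; apply: nonnegM.
case: i => [|[|[|i]]] // _; rewrite logcvx3_hankel.
by apply: nonnegD; apply: nonnegM => //; apply: nonnegM.
Qed.

End TotalPositivity.

(** * Polynomials with nonnegative coefficients form such a cone *)

Section NonnegativeCoefficients.
Context {R : realDomainType} {I : choiceType}.
Implicit Types p q : {malg R[{cmonom I}]}.

Lemma nonneg_coefs0 : nonneg_coefs (0 : {malg R[{cmonom I}]}).
Proof. by move=> m; rewrite mcoeff0. Qed.

Lemma nonneg_coefs1 : nonneg_coefs (1 : {malg R[{cmonom I}]}).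
Proof. by move=> m; rewrite mcoeff1 ler0n. Qed.

Lemma nonneg_coefsD p q :
  nonneg_coefs p -> nonneg_coefs q -> nonneg_coefs (p + q).
Proof. by move=> p0 q0 m; rewrite mcoeffD addr_ge0. Qed.

Lemma nonneg_coefsM p q :
  nonneg_coefs p -> nonneg_coefs q -> nonneg_coefs (p * q).
Proof.
move=> p0 q0 m; rewrite mcoeffMl; apply: sumr_ge0 => m1 _.
by apply: sumr_ge0 => m2 _; rewrite mulrn_wge0 ?mulr_ge0.
Qed.

Lemma nonneg_coefsMn_inv p n : nonneg_coefs (p *+ n.+1) -> nonneg_coefs p.
Proof. by move=> p0 m; have := p0 m; rewrite mcoeffMn pmulrn_lge0. Qed.

End NonnegativeCoefficients.

Theorem theorem3p4 (R : realDomainType) (I : choiceType)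
    (lambda mu T : nat -> {malg R[{cmonom I}]})
    (lambda_ge0 : forall n : nat, nonneg_coefs (lambda n))
    (mu_ge0 : forall n : nat, nonneg_coefs (mu n))
    (T_ge0 : forall n : nat, nonneg_coefs (T n))
    (T_jfraction : is_jfraction lambda mu T) :
  (exists alpha beta : nat -> {malg R[{cmonom I}]},
     [/\ forall n : nat, nonneg_coefs (alpha n),
         forall n : nat, nonneg_coefs (beta n),
         forall n : nat,
           lambda n = beta n + alpha (2 * n)%N + prev alpha (2 * n)%N
       & forall n : nat,
           mu n.+1 = alpha (2 * n)%N * alpha (2 * n + 1)%N]) ->
  xStieltjes T /\ xlogconvex 3 T.
Proof.
case=> al [be [al0 be0 laE muE]].
have eqT n : T n = tableau lambda mu n 0 by exact: jfraction_tableau.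
have tpT : xStieltjes T.
  apply: (@eq_TP _ (@nonneg_coefs R I)
            (hankel (fun n => tableau lambda mu n 0))).
    by move=> i j; rewrite /hankel eqT.
  exact: (TP_hankel_tableau nonneg_coefs0 nonneg_coefs1 (@nonneg_coefsD _ _)
    (@nonneg_coefsM _ _) (@nonneg_coefsMn_inv _ _) al0 be0 laE muE).
split=> // m i le_m3 le_mi.
exact: (TP_hankel_logcvx (@nonneg_coefsD _ _) (@nonneg_coefsM _ _) tpT
  le_m3 le_mi).
Qed.
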